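(* Let $(R,M,k)$ be a complete local ring. Then the following sequence of Abelian groups, whose maps are the inclusion and the map induced by the natural ring map $R\rightarrow k$, is exact and split: $$1\rightarrow 1+M\rightarrow R^{\ast}\rightarrow k^{\ast}\rightarrow 1.$$
   Context: All rings are commutative with $1$. A local ring $(R,M,k)$ is a ring $R$ with a unique maximal ideal $M$ and residue field $k=R/M$. It is called complete if the natural ring map $R\rightarrow\varprojlim_{n\geqslant1}R/M^{n}$, $r\mapsto(r+M^{n})_{n\geqslant1}$, is an isomorphism; $R$ is not assumed to be Noetherian. $R^{\ast}$ denotes the multiplicative group of units of $R$, and $1+M=\{1+x: x\in M\}$ is regarded as a subgroup of $R^{\ast}$. The sequence is split if there is a group homomorphism $s:k^{\ast}\rightarrow R^{\ast}$ whose composition with $R^{\ast}\rightarrow k^{\ast}$ is the identity. *)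

(* Defs.v *)
From HB Require Import structures.
From mathcomp Require Import all_boot all_algebra.
From mathcomp Require Import boolp classical_sets.

Set Implicit Arguments.
Unset Strict Implicit.
Unset Printing Implicit Defensive.

Import GRing.Theory.
Local Open Scope ring_scope.
Local Open Scope quotient_scope.

(* An [idealr R] is a proper ideal of [R], so maximality is among proper
   ideals. *)
Definition maximal_ideal (R : comNzRingType) (I : idealr R) : Prop :=
  forall J : idealr R, {subset I <= J} -> I =i J.

Definition local_ring (R : comNzRingType) (M : idealr R) : Prop :=
  maximal_ideal M /\ forall J : idealr R, maximal_ideal J -> J =i M.

Section IdealProduct.
Variables (R : comNzRingType) (I J : idealr R).

Definition ideal_mul_pred : {pred R} := fun x =>
  `[< exists2 s : seq (R * R),
        {in s, forall p, (p.1 \in I) && (p.2 \in J)}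
      & x = \sum_(p <- s) p.1 * p.2 >].

Fact ideal_mul_closed : idealr_closed ideal_mul_pred.
Proof.
split=> [||a _ _ /asboolP[s sIJ ->] /asboolP[t tIJ ->]].
- by apply/asboolP; exists [::]; rewrite ?big_nil.
- apply/asboolP => -[s sIJ s1]; have := idealr1 I; rewrite s1 big_seq.
  rewrite rpred_sum // => p /sIJ/andP[pI _].
  by rewrite mulrC idealMr.
apply/asboolP; exists ([seq (a * p.1, p.2) | p <- s] ++ t) => [p|].
  rewrite mem_cat => /orP[/mapP[q /sIJ/andP[qI qJ] ->]|/tIJ //] /=.
  by rewrite idealMr.
rewrite big_cat big_map mulr_sumr /=; congr (_ + _).
by apply: eq_bigr => p _; rewrite mulrA.
Qed.

HB.instance Definition _ := isIdealr.Build R ideal_mul_pred ideal_mul_closed.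

Definition ideal_mul : idealr R := ideal_mul_pred.

End IdealProduct.

(* [ideal_expS I n] is the power I^(n+1): the shift keeps out I^0 = R, which is
   not a proper ideal. *)
Definition ideal_expS (R : comNzRingType) (I : idealr R) (n : nat) : idealr R :=
  iter n (ideal_mul I) I.

(* The inverse limit of the rings R/I^n, n >= 1, as a ring. *)
Section AdicLimit.
Variables (R : comNzRingType) (I : idealr R).
Local Notation Q n := {ideal_quot ideal_expS I n}.

Definition adic_proj (n : nat) (x : Q n.+1) : Q n := \pi_(Q n) (repr x).

Fact ideal_expS_sub n : {subset ideal_expS I n.+1 <= ideal_expS I n}.
Proof.
move=> _ /asboolP[s sI ->]; rewrite big_seq rpred_sum // => p /sI/andP[_ pJ].
exact: idealMr.
Qed.

Fact adic_proj_pi n x : adic_proj (\pi_(Q n.+1) x) = \pi_(Q n) x.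
Proof.
apply/eqP; rewrite /adic_proj -Quotient.idealrBE ideal_expS_sub //.
by rewrite Quotient.idealrBE reprK.
Qed.

Fact adic_proj_is_zmod_morphism n : zmod_morphism (@adic_proj n).
Proof.
move=> x y; rewrite -[x]reprK -[y]reprK -rmorphB !adic_proj_pi.
exact: rmorphB.
Qed.

Fact adic_proj_is_monoid_morphism n : monoid_morphism (@adic_proj n).
Proof.
split=> [|x y]; first by rewrite -(rmorph1 (\pi_(Q n.+1))) adic_proj_pi rmorph1.
rewrite -[x]reprK -[y]reprK -rmorphM !adic_proj_pi.
exact: rmorphM.
Qed.

HB.instance Definition _ n := GRing.isZmodMorphism.Build _ _ (@adic_proj n)
  (@adic_proj_is_zmod_morphism n).
HB.instance Definition _ n := GRing.isMonoidMorphism.Build _ _ (@adic_proj n)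
  (@adic_proj_is_monoid_morphism n).

Record adic_limit := AdicLimit {
  adic_coord :> forall n, Q n;
  adic_coordP : forall n, adic_proj (adic_coord n.+1) = adic_coord n }.

HB.instance Definition _ := gen_eqMixin adic_limit.
HB.instance Definition _ := gen_choiceMixin adic_limit.

Lemma adic_limit_eq (x y : adic_limit) : (forall n, x n = y n) -> x = y.
Proof.
case: x y => [x xP] [y yP] /= xy; move: yP.
rewrite -(functional_extensionality_dep xy) => yP.
by congr AdicLimit; apply: Prop_irrelevance.
Qed.

Definition adic_zero : adic_limit :=
  AdicLimit (fun n => rmorph0 (@adic_proj n)).
Definition adic_one : adic_limit :=
  AdicLimit (fun n => rmorph1 (@adic_proj n)).

Program Definition adic_opp (x : adic_limit) : adic_limit :=
  @AdicLimit (fun n => - x n) _.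
Next Obligation. by rewrite rmorphN /= adic_coordP. Qed.
Program Definition adic_add (x y : adic_limit) : adic_limit :=
  @AdicLimit (fun n => x n + y n) _.
Next Obligation. by rewrite rmorphD /= !adic_coordP. Qed.
Program Definition adic_mul (x y : adic_limit) : adic_limit :=
  @AdicLimit (fun n => x n * y n) _.
Next Obligation. by rewrite rmorphM /= !adic_coordP. Qed.

Fact adic_addA : associative adic_add.
Proof. by move=> x y z; apply: adic_limit_eq => n; apply: addrA. Qed.
Fact adic_addC : commutative adic_add.
Proof. by move=> x y; apply: adic_limit_eq => n; apply: addrC. Qed.
Fact adic_add0 : left_id adic_zero adic_add.
Proof. by move=> x; apply: adic_limit_eq => n; apply: add0r. Qed.
Fact adic_addN : left_inverse adic_zero adic_opp adic_add.
Proof. by move=> x; apply: adic_limit_eq => n; apply: addNr. Qed.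

HB.instance Definition _ := GRing.isZmodule.Build adic_limit
  adic_addA adic_addC adic_add0 adic_addN.

Fact adic_mulA : associative adic_mul.
Proof. by move=> x y z; apply: adic_limit_eq => n; apply: mulrA. Qed.
Fact adic_mulC : commutative adic_mul.
Proof. by move=> x y; apply: adic_limit_eq => n; apply: mulrC. Qed.
Fact adic_mul1 : left_id adic_one adic_mul.
Proof. by move=> x; apply: adic_limit_eq => n; apply: mul1r. Qed.
Fact adic_mulDl : left_distributive adic_mul adic_add.
Proof. by move=> x y z; apply: adic_limit_eq => n; apply: mulrDl. Qed.
Fact adic_one_neq0 : adic_one != 0.
Proof.
by apply/eqP => /(congr1 (fun x : adic_limit => x 0%N))/eqP; apply/negP/oner_neq0.
Qed.

HB.instance Definition _ := GRing.Zmodule_isComNzRing.Build adic_limit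
  adic_mulA adic_mulC adic_mul1 adic_mulDl adic_one_neq0.

Definition adic_map (r : R) : adic_limit :=
  @AdicLimit (fun n => \pi_(Q n) r) (fun n => adic_proj_pi n r).

Fact adic_map_is_zmod_morphism : zmod_morphism adic_map.
Proof. by move=> x y; apply: adic_limit_eq => n; apply: rmorphB. Qed.
Fact adic_map_is_monoid_morphism : monoid_morphism adic_map.
Proof.
split=> [|x y]; apply: adic_limit_eq => n; [exact: rmorph1 | exact: rmorphM].
Qed.

HB.instance Definition _ := GRing.isZmodMorphism.Build R adic_limit adic_map
  adic_map_is_zmod_morphism.
HB.instance Definition _ := GRing.isMonoidMorphism.Build R adic_limit adic_map
  adic_map_is_monoid_morphism.

End AdicLimit.

(* [adic_map I] is a ring morphism, so it is an isomorphism when bijective. *)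
Definition adic_complete (R : comNzRingType) (I : idealr R) : Prop :=
  bijective (adic_map I).

(* A quotient of a [comNzRingType] has no unit structure in the library:
   invertibility is decided classically here. *)
Section QuotientUnits.
Variables (R : comNzRingType) (I : idealr R).
Local Notation Q := {ideal_quot I}.

Definition quot_unit : {pred Q} := fun x => `[< exists y, y * x = 1 >].
Definition quot_inv (x : Q) : Q :=
  if pselect (exists y, y * x = 1) is left ex then projT1 (cid ex) else x.

Fact quot_mulVr : {in quot_unit, left_inverse 1 quot_inv *%R}.
Proof.
by move=> x /asboolP xU; rewrite /quot_inv; case: pselect => // ex; case: cid.
Qed.
Fact quot_unitP (x y : Q) : y * x = 1 -> quot_unit x.
Proof. by move=> yx1; apply/asboolP; exists y. Qed.
Fact quot_inv_out : {in [predC quot_unit], quot_inv =1 id}.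
Proof.
by move=> x /asboolP xU; rewrite /quot_inv; case: pselect.
Qed.

HB.instance Definition _ := GRing.ComNzRing_hasMulInverse.Build Q
  quot_mulVr quot_unitP quot_inv_out.

End QuotientUnits.

(* The library's [{unit R}] is restricted to finite rings. *)
Section UnitGroup.
Variable R : comUnitRingType.

Record unit_group := UnitGroup {
  unit_val :> R;
  unit_valP : unit_val \is a GRing.unit }.

HB.instance Definition _ := [isSub for unit_val].
HB.instance Definition _ := [Choice of unit_group by <:].

Definition unit_one := UnitGroup (unitr1 R).
Program Definition unit_mul (u v : unit_group) :=
  @UnitGroup (unit_val u * unit_val v) _.
Next Obligation. by rewrite unitrM !unit_valP. Qed.
Program Definition unit_inv (u : unit_group) := @UnitGroup (unit_val u)^-1 _.
Next Obligation. by rewrite unitrV unit_valP. Qed.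

Fact unit_mulA : associative unit_mul.
Proof. by move=> u v w; apply: val_inj; apply: mulrA. Qed.
Fact unit_mul1 : left_id unit_one unit_mul.
Proof. by move=> u; apply: val_inj; apply: mul1r. Qed.
Fact unit_mulr1 : right_id unit_one unit_mul.
Proof. by move=> u; apply: val_inj; apply: mulr1. Qed.
Fact unit_mulV : left_inverse unit_one unit_inv unit_mul.
Proof. by move=> u; apply: val_inj; apply: mulVr (unit_valP u). Qed.
Fact unit_mulrV : right_inverse unit_one unit_inv unit_mul.
Proof. by move=> u; apply: val_inj; apply: mulrV (unit_valP u). Qed.

HB.instance Definition _ := isGroup.Build unit_group
  unit_mulA unit_mul1 unit_mulr1 unit_mulV unit_mulrV.

Lemma unit_mulC : commutative (fun u v : unit_group => u * v)%g.
Proof. by move=> u v; apply: val_inj; apply: mulrC. Qed.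

End UnitGroup.

Section UnitMap.
Variables (R S : comUnitRingType) (f : {rmorphism R -> S}).

Definition unit_map (u : unit_group R) : unit_group S :=
  UnitGroup (rmorph_unit f (unit_valP u)).

Fact unit_mapM : {morph unit_map : u v / (u * v)%g}.
Proof. by move=> u v; apply: val_inj; apply: rmorphM. Qed.

HB.instance Definition _ :=
  isMultiplicative.Build (unit_group R) (unit_group S) unit_map unit_mapM.

End UnitMap.

Section OnePlus.
Variables (R : comUnitRingType) (M : idealr R).

(* [1 + M] as a subset of the group of units; when [M] is the maximal ideal of a
   local ring this is all of [1 + M], see [one_plus_unit]. *)
Definition one_plus_pred : {pred unit_group R} :=
  fun u => `[< exists2 x, x \in M & unit_val u = 1 + x >].

Lemma one_plusE (u : unit_group R) :
  (u \in one_plus_pred) = (unit_val u - 1 \in M).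
Proof.
apply/asboolP/idP => [[x xM ->]|uM]; first by rewrite addrC addKr.
by exists (unit_val u - 1); rewrite ?subrKC.
Qed.

Fact one_plus_closed : group_closed one_plus_pred.
Proof.
split=> [|u v]; rewrite !one_plusE; first by rewrite subrr rpred0.
move=> uM vM; have -> : unit_val (u / v)%g - 1
    = (unit_val v)^-1 * ((unit_val u - 1) - (unit_val v - 1)).
  rewrite opprB addrA subrK mulrBr mulVr ?unit_valP //.
  by rewrite mulrC.
by rewrite idealMr // rpredB.
Qed.

Definition one_plus := {u : unit_group R | u \in one_plus_pred}.
HB.instance Definition _ := SubChoice.on one_plus.
HB.instance Definition _ := SubChoice_isSubGroup.Build
  (unit_group R) one_plus_pred one_plus one_plus_closed.

Definition one_plus_incl : {multiplicative one_plus -> unit_group R} :=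
  (val : one_plus -> unit_group R).

End OnePlus.

Definition residue_map (R : comUnitRingType) (M : idealr R) :
    {multiplicative unit_group R -> unit_group {ideal_quot M}} :=
  unit_map (\pi_{ideal_quot M} : {rmorphism R -> {ideal_quot M}}).

Section LocalUnits.
Variables (R : comUnitRingType) (M : idealr R).
Hypothesis locM : local_ring M.

Section PrincipalIdeal.
Variables (x : R) (xN : x \isn't a GRing.unit).

Definition principal_pred : {pred R} := fun y => `[< exists a, y = a * x >].

Fact principal_closed : idealr_closed principal_pred.
Proof.
split=> [||a _ _ /asboolP[b ->] /asboolP[c ->]].
- by apply/asboolP; exists 0; rewrite mul0r.
- apply/asboolP => -[a /esym ax1]; case/negP: xN.
  by apply/unitrPr; exists a; rewrite mulrC.
by apply/asboolP; exists (a * b + c); rewrite mulrDl mulrA.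
Qed.

HB.instance Definition _ := isIdealr.Build R principal_pred principal_closed.

Definition principal : idealr R := principal_pred.

Lemma mem_principal : x \in principal.
Proof. by apply/asboolP; exists 1; rewrite mul1r. Qed.

End PrincipalIdeal.

Section ChainUnion.
Variables (F : set (idealr R)) (J0 : idealr R).
Hypothesis FJ0 : F J0.
Hypothesis Ftot : forall I J, F I -> F J ->
  {subset I <= J} \/ {subset J <= I}.

Definition union_pred : {pred R} := fun y => `[< exists2 J, F J & y \in J >].

Fact union_closed : idealr_closed union_pred.
Proof.
split=> [||a u v /asboolP[I FI uI] /asboolP[J FJ vJ]].
- by apply/asboolP; exists J0; rewrite ?rpred0.
- by apply/asboolP => -[J _]; rewrite idealr1.
apply/asboolP; have [IJ|JI] := Ftot FI FJ.
  by exists J => //; apply: rpredD => //; apply: idealMr; apply: IJ.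
by exists I => //; apply: rpredD; [apply: idealMr | apply: JI].
Qed.

HB.instance Definition _ := isIdealr.Build R union_pred union_closed.

Definition ideal_union : idealr R := union_pred.

End ChainUnion.

Lemma local_nonunit x : x \isn't a GRing.unit -> x \in M.
Proof.
move=> xN; pose T := {J : idealr R | x \in J}.
pose t0 : T := exist _ (principal xN) (mem_principal xN).
pose le (s t : T) := `[< {subset sval s <= sval t} >].
have [t|r s t|A Atot|[J xJ] Jmax] := @ZL_preorder T t0 le.
- exact/asboolP.
- move=> /asboolP rs /asboolP st; apply/asboolP => y /rs; exact: st.
- have [[s0 As0]|A0] := pselect (exists s, A s); last first.
    by exists t0 => s As; case: A0; exists s.
  pose F : set (idealr R) := fun J => exists2 s, A s & sval s = J.
  have Ftot I J : F I -> F J -> {subset I <= J} \/ {subset J <= I}.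
    move=> [s As <-] [t At <-].
    by have [/asboolP|/asboolP] := Atot s t As At; [left | right].
  have FJ0 : F (sval s0) by exists s0.
  have xU : x \in ideal_union FJ0 Ftot.
    by apply/asboolP; exists (sval s0) => //; exact: (svalP s0).
  exists (exist _ (ideal_union FJ0 Ftot) xU) => s As; apply/asboolP => y ys.
  by apply/asboolP; exists (sval s) => //; exists s.
rewrite -(locM.2 J) // => K JK y; apply/idP/idP; first exact: JK.
have xK : x \in K by exact: JK.
by have /asboolP := Jmax (exist _ K xK) (asboolT JK); apply.
Qed.

Lemma local_unitE x : (x \is a GRing.unit) = (x \notin M).
Proof.
apply/idP/idP => [xU|]; last by apply: contraR; exact: local_nonunit.
by apply/negP => /(idealMr x^-1); rewrite mulVr // idealr1.
Qed.

Lemma one_plus_unit x : x \in M -> 1 + x \is a GRing.unit.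
Proof.
move=> xM; rewrite local_unitE; apply/negP => /rpredB/(_ xM).
by rewrite addrK idealr1.
Qed.

Lemma residue_field (y : {ideal_quot M}) : y != 0 -> y \is a GRing.unit.
Proof.
rewrite -[y]reprK => y0.
have -> : \pi_{ideal_quot M} (repr y)
    = (\pi_{ideal_quot M} : {rmorphism R -> {ideal_quot M}}) (repr y) by [].
apply: rmorph_unit; rewrite local_unitE; apply: contra y0 => yM.
by rewrite -(rmorph0 \pi_{ideal_quot M}) -Quotient.idealrBE subr0.
Qed.

End LocalUnits.

Local Open Scope classical_set_scope.

Definition gker (G H : groupType) (f : {multiplicative G -> H}) : set G :=
  [set x | f x = 1%g].

(* Exactness of 1 -> A -> B -> C -> 1 at A, B and C. *)
Definition short_exact (A B C : groupType)
    (f : {multiplicative A -> B}) (g : {multiplicative B -> C}) : Prop :=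
  [/\ gker f = [set 1%g], range f = gker g & range g = [set: C]].

Definition splits (B C : groupType) (g : {multiplicative B -> C}) : Prop :=
  exists s : {multiplicative C -> B}, g \o s = idfun.

(* Main.v *)
From HB Require Import structures.
Require Import Defs.
From mathcomp Require Import all_boot all_algebra.
From mathcomp Require Import boolp classical_sets.

Import GRing.Theory.

(** Exactness is the fact that the units are the elements outside [M]; the
splitting is the real content. It is obtained as a complement [T] of [K = 1 + M] in the
abelian group [G] of units of [R]: a subgroup that meets every coset of [K]
in exactly one point, so that the residue map restricts to a bijection on [T]
([complement_splits]). Ordinary choice of lifts of generators fails as soon as
relations must be respected, and two different mechanisms take care of them
according to the residue characteristic.

If every positive integer is invertible in [R], then [K] is divisible: an
approximate [m]-th root with error [1 + x] is improved by the factor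
[1 + x / m], and completeness provides the limit ([one_plus_exp_root],
[filtration_divisible]). A divisible subgroup of an abelian group has a
complement ([divisible_complement]).

If a prime [p] lies in [M], then [K] need not be divisible by [p], but the
residue field has no [p]-torsion in its unit group, and raising to the power
[p] pushes [1 + M^n] into [1 + M^(n+1)]. Choose a subgroup [U] of [G] such that
[U / U^p] maps isomorphically onto the quotient of the units of the residue
field by the [p]-th powers: [G = U G^p K], and every element of [U] that is a
[p]-th power modulo [K] is a [p]-th power in [U]. Iterating, every unit is
congruent modulo [M] to some [u y^(p^n)] with [u] in [U]; two such elements
congruent modulo [M] are congruent modulo [M^(n+1)], because their quotient is
the [p^n]-th power of an element of [K]. Hence the elements [u y^(p^n)] lifting
a given residue converge as [n] grows, as in the construction of Teichmueller
representatives, which is the case [U = 1] of a perfect residue field. The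
limits form the complement ([pfiltration_complement]).

Both the divisible case and the choice of [U] come from one application of
Zorn's lemma: [exists_maximal_pure] gives a maximal subgroup [U] such that
[U] meets [G^n K] inside [U^n], and is used with [n = 0] (where it says that
[U] meets [K] trivially) and with [n = p]. *)

(** * Subgroups of an abelian group *)

Section AbelianGroup.
Set Implicit Arguments.
Unset Strict Implicit.
Local Open Scope classical_set_scope.
Local Open Scope group_scope.

Variable G : groupType.
Hypothesis GC : forall x y : G, commute x y.

Definition subgroup (A : set G) : Prop :=
  A 1 /\ forall x y, A x -> A y -> A (x / y).

Lemma subgroupV A x : subgroup A -> A x -> A x^-1.
Proof. by move=> [A1 AF] Ax; rewrite -div1g; apply: AF. Qed.

Lemma subgroupM A x y : subgroup A -> A x -> A y -> A (x * y).
Proof.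
by move=> sA Ax Ay; rewrite -[y]invgK; apply: sA.2 => //; apply: subgroupV.
Qed.

Lemma subgroupX A x n : subgroup A -> A x -> A (x ^+ n).
Proof.
move=> sA Ax; elim: n => [|n IHn]; first exact: sA.1.
by rewrite expgS; apply: subgroupM.
Qed.

Lemma mulgACA (x y z t : G) : (x * y) * (z * t) = (x * z) * (y * t).
Proof. by rewrite !mulgA -(mulgA x) (GC y) mulgA. Qed.

Lemma divgACA (x y z t : G) : (x * y) / (z * t) = (x / z) * (y / t).
Proof. by rewrite invgM (GC t^-1) mulgACA. Qed.

Lemma mulgDiv (x y : G) : x * (y / x) = y.
Proof. by rewrite GC mulgVK. Qed.

(** The product [A B] of two subgroups; membership reads as congruence to an
element of [A] modulo [B]. *)
Definition mulset (A B : set G) : set G := [set x | exists2 a, A a & B (x / a)].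

Lemma mulset_subgroup A B : subgroup A -> subgroup B -> subgroup (mulset A B).
Proof.
move=> sA sB; split.
  by exists 1; [exact: sA.1 | rewrite divg1; exact: sB.1].
move=> x y [a Aa Bxa] [b Ab Byb]; exists (a / b); first exact: sA.2.
rewrite divgACA -invgM (GC b^-1); exact: sB.2.
Qed.

Definition powers (n : nat) : set G := [set x | exists y, x = y ^+ n].

Lemma powers_subgroup n : subgroup (powers n).
Proof.
split=> [|_ _ [x ->] [y ->]]; first by exists 1; rewrite expg1n.
by exists (x / y); rewrite expgnFl.
Qed.

(** The exponents [d] with [x^d] in [A] form an ideal of the integers; its
generator [m] is the order of [x] modulo [A], with [m = 0] for infinite
order. *)
Lemma power_index (A : set G) x : subgroup A ->
  exists m, forall d, A (x ^+ d) <-> m %| d.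
Proof.
move=> sA; pose pos d := (0 < d) && `[< A (x ^+ d) >].
have [posA|nA] := pselect (exists d, pos d).
  exists (ex_minn posA); case: ex_minnP => m /andP[m0 /asboolP Am] mmin d.
  split=> [Ad|/dvdnP[q ->]]; last by rewrite mulnC expgnA; apply: subgroupX.
  rewrite /dvdn; case: posnP => // r0.
  have /mmin : pos (d %% m).
    rewrite /pos r0; apply/asboolP.
    have -> : x ^+ (d %% m) = x ^+ d / x ^+ (d %/ m * m).
      by rewrite {2}(divn_eq d m) addnC expgnDr mulgK.
    by apply: sA.2 => //; rewrite mulnC expgnA; apply: subgroupX.
  by rewrite leqNgt ltn_mod m0.
exists 0 => d; split=> [Ad|]; last by rewrite dvd0n => /eqP->; exact: sA.1.
rewrite dvd0n eqn0Ngt; apply/negP => d0; apply: nA; exists d.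
by rewrite /pos d0; apply/asboolP.
Qed.

(** The subgroup generated by [U] and [x]; the quotient of two natural powers
stands for an integer power. *)
Definition adjoin (U : set G) (x : G) : set G :=
  [set w | exists u i j, U u /\ w = u * (x ^+ i / x ^+ j)].

Lemma adjoin_subgroup U x : subgroup U -> subgroup (adjoin U x).
Proof.
move=> sU; split.
  by exists 1, 0, 0; rewrite mulgV mulg1; split=> //; exact: sU.1.
move=> _ _ [u [i [j [Uu ->]]]] [v [k [l [Uv ->]]]].
exists (u / v), (i + l), (j + k); split; first exact: sU.2.
by rewrite divgACA invgF (mulgACA (x ^+ i)) -expgnDr -invgM -expgnDr (addnC k).
Qed.

Lemma sub_adjoin U x u : U u -> adjoin U x u.
Proof. by exists u, 0, 0; rewrite mulgV mulg1. Qed.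

Lemma mem_adjoin U x : subgroup U -> adjoin U x x.
Proof.
move=> sU; exists 1, 1%N, 0; rewrite mul1g expg1 expg0 divg1; split=> //.
exact: sU.1.
Qed.

Lemma adjoinP U x w : adjoin U x w ->
  exists u z d, [/\ U u, z = x \/ z = x^-1 & w = u * z ^+ d].
Proof.
move=> [u [i [j [Uu ->]]]]; have [le_ij|/ltnW le_ji] := leqP i j.
  exists u, x^-1, (j - i); split; [by [] | by right |].
  by rewrite expVgn expgnFr // invgF.
by exists u, x, (i - j); split; [| left |rewrite expgnFr].
Qed.

(** * Pure subgroups modulo a subgroup *)

Section Pure.
Variable K : set G.
Hypothesis sK : subgroup K.

Definition powK n := mulset (powers n) K.

Lemma powK_subgroup n : subgroup (powK n).
Proof. exact: mulset_subgroup (powers_subgroup n) sK. Qed.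

Lemma powK_pow n x : powK n (x ^+ n).
Proof. by exists (x ^+ n); [exists x | rewrite mulgV; exact: sK.1]. Qed.

Lemma powK0 x : powK 0 x <-> K x.
Proof.
split=> [[_ [y ->]]|Kx]; first by rewrite expg0 divg1.
by exists 1; [exists 1 | rewrite divg1].
Qed.

(** With [n = 0] this says that [U] and [K] intersect trivially; for a prime
[n] it says that the image of [U] in [G / K] is [n]-pure and that [n]-th roots
can be found in [U] itself. *)
Definition pure (n : nat) (U : set G) : Prop :=
  forall u, U u -> powK n u -> exists2 v, U v & u = v ^+ n.

(** An element [u x^d] of [G^n K] forces [x^d] into [U G^n K]. The hypothesis on
[x] leaves two cases: [x^d] is in [U] and purity of [U] applies, or [x^d] is an
[n]-th power of a power of [x], which can be divided out. *)
Lemma adjoin_pure n U x : subgroup U -> pure n U ->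
  (forall d, mulset U (powK n) (x ^+ d) -> U (x ^+ d) \/ n %| d) ->
  pure n (adjoin U x).
Proof.
move=> sU pU xP w Aw Nw; have [u [z [d [Uu zx wE]]]] := adjoinP Aw.
have sN := powK_subgroup n; have sA := adjoin_subgroup x sU.
have UNz : mulset U (powK n) (z ^+ d).
  exists u^-1; first exact: subgroupV.
  by rewrite invgK GC -wE.
have Az : adjoin U x z.
  by case: zx => ->; [|apply: subgroupV => //]; apply: mem_adjoin.
have [Uz|/dvdnP[e dE]] : U (z ^+ d) \/ n %| d.
- case: zx => zE; rewrite zE in UNz *; first exact: xP.
  have /xP : mulset U (powK n) (x ^+ d).
    rewrite -[x ^+ d]invgK -expVgn; apply: subgroupV => //.
    exact: mulset_subgroup.
  by case=> [Ux|]; [left; rewrite expVgn; apply: subgroupV | right].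
- have [|v Uv ->] := pU w _ Nw; first by rewrite wE; apply: subgroupM.
  by exists v => //; apply: sub_adjoin.
have [|v Uv uE] := pU u Uu.
  rewrite -(mulgK (z ^+ d) u) -wE dE expgnA.
  by apply: sN.2 => //; apply: powK_pow.
exists (v * z ^+ e).
  by apply: subgroupM => //; [apply: sub_adjoin | apply: subgroupX].
by rewrite expgMn // -uE -expgnA -dE.
Qed.

(** Zorn's lemma on pure subgroups: maximality is recorded in the form in which
it is used, by testing it against [adjoin U x]. *)
Lemma exists_maximal_pure n : exists U, [/\ subgroup U, pure n U &
  forall x, (forall d, mulset U (powK n) (x ^+ d) -> U (x ^+ d) \/ n %| d) ->
    U x].
Proof.
(* [Zorn_bigcup] also ranges over the empty chain, so [P] must hold of the
   empty set: it asks for the unit only in a nonempty [U]. *)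
pose P (U : set G) :=
  [/\ forall x, U x -> U 1, forall x y, U x -> U y -> U (x / y) & pure n U].
have [F FP Ftot|U [[U1 UF pU] Umax]] := @Zorn_bigcup G P.
  split.
  - move=> x [X FX Xx]; exists X => //.
    by have [X1 _ _] := FP _ FX; apply: X1 Xx.
  - move=> x y [X FX Xx] [Y FY Yy].
    have [XY|YX] := Ftot X Y FX FY.
      by exists Y => //; have [_ YF _] := FP _ FY; apply: YF => //; apply: XY.
    by exists X => //; have [_ XF _] := FP _ FX; apply: XF => //; apply: YX.
  - move=> u [X FX Xu] Nu; have [_ _ pX] := FP _ FX.
    by have [v Xv ->] := pX u Xu Nu; exists v => //; exists X.
have maxU V : U `<=` V -> P V -> V `<=` U.
  by move=> UV PV; apply: contrapT => nVU; apply: (Umax V) => //; split.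
(* If [U] were empty, adding [1] would enlarge it. *)
have sU : subgroup U.
  split=> //; apply: (maxU [set x | x = 1 \/ U x]) => /=; [by right| | by left].
  split=> [x _|x y|u]; first by left.
    case=> [->|Ux] [->|Uy]; first by left; rewrite divg1.
    - by right; apply: UF => //; apply: U1 Uy.
    - by right; rewrite divg1.
    - by right; apply: UF.
  case=> [-> _|Uu Nu]; first by exists 1; rewrite ?expg1n //; left.
  by have [v Uv ->] := pU u Uu Nu; exists v => //; right.
exists U; split=> // x xP; apply: (maxU (adjoin U x)); last exact: mem_adjoin.
  by move=> u; apply: sub_adjoin.
have [A1 AF] := adjoin_subgroup x sU.
by split=> //; apply: adjoin_pure.
Qed.

Definition complement (T : set G) : Prop :=
  [/\ subgroup T, forall t, T t -> K t -> t = 1 &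
      forall x, exists2 t, T t & K (x / t)].

(** Let [U] be maximal among the subgroups meeting [K] trivially, and let [m] be
the order of [x] modulo [U K], so that [x^m = u v] with [v] in [K]. Divisibility
gives [v = w^m], and [y = x / w] is congruent to [x] and satisfies [y^m = u]:
now every power of [y] lying in [U K] lies in [U], so [y] is in [U]. *)
Lemma divisible_complement :
  (forall n v, 0 < n -> K v -> exists2 w, K w & v = w ^+ n) ->
  exists T, complement T.
Proof.
move=> divK; have [U [sU pU Umax]] := exists_maximal_pure 0.
exists U; split=> // [t Ut /powK0 Nt|x]; first by have [v _ ->] := pU t Ut Nt.
have sUN := mulset_subgroup sU (powK_subgroup 0).
have [m mP] := power_index x sUN.
have [u Uu /powK0 Kv] : mulset U (powK 0) (x ^+ m) by apply/mP.
(* For [m = 0] the element [x] itself is independent of [U] modulo [K], and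
   [w = 1] works since then [u = 1]. *)
have [w Kw vE] : exists2 w, K w & x ^+ m / u = w ^+ m.
  have [m0|m0] := posnP m; last exact: divK.
  exists 1; first exact: sK.1.
  rewrite m0 !expg0 in Kv *.
  have [|v _ ->] := pU u Uu; last by rewrite expg0 divg1.
  by apply/powK0; rewrite -[u]invgK; apply: (subgroupV sK); rewrite -div1g.
have yE : (x / w) ^+ m = u.
  by rewrite expgnFl // -vE divKg.
exists (x / w); last by rewrite divKg.
apply: Umax => d UNd; left.
have /mP/dvdnP[q ->] : mulset U (powK 0) (x ^+ d).
  have -> : x ^+ d = (x / w) ^+ d * w ^+ d by rewrite -expgMn // mulgVK.
  apply: subgroupM => //; exists 1; first exact: sU.1.
  by rewrite divg1; apply/powK0; apply: subgroupX.
by rewrite mulnC expgnA yE; apply: subgroupX.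
Qed.

Section Torsion.
Variable p : nat.
Hypothesis p_prime : prime p.
Hypothesis torsK : forall x, K (x ^+ p) -> K x.

(** The order of [x] modulo [U G^p K] divides [p]. If it is [p], then [x] passes
the test of [exists_maximal_pure] and is in [U] after all. *)
Lemma exists_pure_cover : exists U, [/\ subgroup U, pure p U &
  forall x, mulset U (powK p) x].
Proof.
have [U [sU pU Umax]] := exists_maximal_pure p.
exists U; split=> // x; have sN := powK_subgroup p.
have sUN := mulset_subgroup sU sN.
have [m mP] := power_index x sUN.
have /mP : mulset U (powK p) (x ^+ p).
  by exists 1; [exact: sU.1 | rewrite divg1; apply: powK_pow].
move=> /((primeP p_prime).2 m)/orP[/eqP m1|/eqP mp].
  by rewrite -[x]expg1; apply/mP; rewrite m1.
exists x; last by rewrite mulgV; exact: sN.1.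
by apply: Umax => d /mP; rewrite mp; right.
Qed.

Lemma expg_torsionfree n x : K (x ^+ (p ^ n)) -> K x.
Proof.
elim: n => [|n IHn]; first by rewrite expn0 expg1.
by rewrite expnSr expgnA => /torsK/IHn.
Qed.

(** Without [p]-torsion in [G / K] the root in [U] of [u] is congruent to the
root in [G] that is given, which lets purity for [p] be applied again. *)
Lemma pure_iter U n u y : pure p U -> U u -> K (u / y ^+ (p ^ n)) ->
  exists2 w, U w & u = w ^+ (p ^ n).
Proof.
move=> pU; elim: n u => [|n IHn] u Uu; first by exists u.
rewrite expnSr expgnA => Ku.
have [|v Uv uE] := pU u Uu.
  by exists ((y ^+ (p ^ n)) ^+ p) => //; exists (y ^+ (p ^ n)).
rewrite uE -expgnFl // in Ku; have [w Uw vE] := IHn v Uv (torsK Ku).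
by exists w; rewrite // uE vE -expgnA.
Qed.

(** From [x = u y^(p^n)] and [y = v z^p] modulo [K] follows
[x = u v^(p^n) z^(p^(n+1))]. *)
Lemma iter_cover U n x : subgroup U -> (forall x, mulset U (powK p) x) ->
  exists2 b, mulset U (powers (p ^ n)) b & K (x / b).
Proof.
move=> sU Ucov; elim: n => [|n [b [u Uu [y bE]] Kb]].
  exists x; last by rewrite mulgV; exact: sK.1.
  by exists 1; [exact: sU.1 | exists x; rewrite divg1 expn0 expg1].
have [v Uv [_ [z ->] Kz]] := Ucov y.
exists (u * (v * z ^+ p) ^+ (p ^ n)).
  exists (u * v ^+ (p ^ n)); first by apply: subgroupM => //; apply: subgroupX.
  exists z; rewrite divgACA mulgV mul1g -expgnFl // GC mulgA mulVg mul1g.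
  by rewrite expnS expgnA.
rewrite -[x](mulgVK b) -mulgA; apply: subgroupM => //.
rewrite -(mulgDiv u b) bE divgACA mulgV mul1g -expgnFl //.
by apply: subgroupX => //; rewrite invgM (GC (z ^- p)) mulgA.
Qed.

End Torsion.
End Pure.

(** * Complete separated filtrations *)

Section Filtration.
Variable W : nat -> set G.
Hypothesis sW : forall n, subgroup (W n).
Hypothesis Wsub : forall n, W n.+1 `<=` W n.
Hypothesis Wsep : forall x, (forall n, W n x) -> x = 1.
Hypothesis Wlim : forall b : nat -> G, (forall n, W n (b n.+1 / b n)) ->
  exists r, forall n, W n (r / b n).

Lemma filtration_sub0 n : W n `<=` W 0.
Proof. by elim: n => [|n IHn] // x /Wsub/IHn. Qed.

(** Successive approximation: [b n] is an [m]-th root of [v] up to [W n], and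
[f] supplies the factor that corrects it one step further. *)
Lemma filtration_divisible m :
  (forall n v, W n v -> exists2 w, W n w & W n.+1 (v / w ^+ m)) ->
  forall v, W 0 v -> exists2 w, W 0 w & v = w ^+ m.
Proof.
move=> step v Wv.
have /choice[f fP] (nx : nat * G) : exists w, W nx.1 nx.2 ->
    W nx.1 w /\ W nx.1.+1 (nx.2 / w ^+ m).
  have [/step[w]|] := pselect (W nx.1 nx.2); last by exists 1.
  by exists w.
pose b := fix b n := if n is k.+1 then b k * f (k, v / b k ^+ m) else 1.
have bP n : W n (v / b n ^+ m).
  elim: n => [|n IHn] /=; first by rewrite expg1n divg1.
  have [_] := fP (n, v / b n ^+ m) IHn.
  by rewrite expgMn // invgM (GC (f _ ^- _)) mulgA.
have [|r rP] := Wlim (b := b).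
  by move=> n; rewrite /= GC mulgA mulVg mul1g; case: (fP (n, _) (bP n)).
exists r; first by have := rP 0; rewrite divg1.
apply: divg1_eq; apply: Wsep => n.
rewrite -[v](mulgVK (b n ^+ m)) -mulgA; apply: subgroupM => //.
by rewrite -expgnFl // -invgF expVgn; apply: subgroupV => //; apply: subgroupX.
Qed.

(** [B n] is the group of the approximations [u y^(p^n)]. By [BW] it meets [W 0]
inside [W n], so the approximations to a given coset of [W 0] form a Cauchy
sequence; the complement is the set of limits, the intersection of the groups
[B n W n]. *)
Lemma pfiltration_complement p : prime p ->
  (forall x, W 0 (x ^+ p) -> W 0 x) ->
  (forall n x, W n x -> W n.+1 (x ^+ p)) ->
  exists T, complement (W 0) T.
Proof.
move=> p_prime tors Wp.
have [U [sU pU Ucov]] := exists_pure_cover (sW 0) p_prime.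
pose B n := mulset U (powers (p ^ n)).
have sB n : subgroup (B n).
  exact: mulset_subgroup sU (powers_subgroup _).
have Bsub n : B n.+1 `<=` B n.
  move=> x [u Uu [y xE]]; exists u => //; exists (y ^+ p).
  by rewrite -expgnA -expnS.
have WpX n x : W 0 x -> W n (x ^+ (p ^ n)).
  by move=> Wx; elim: n => [|n IHn] //; rewrite expnSr expgnA; apply: Wp.
have BW n b : B n b -> W 0 b -> W n b.
  move=> [u Uu [y bE]] Wb.
  have uE : b = u * y ^+ (p ^ n) by rewrite -bE mulgDiv.
  have [|w Uw wE] := pure_iter (y := y^-1) tors pU Uu (n := n).
    by rewrite expVgn invgK -uE.
  move: Wb; rewrite uE wE -expgMn // => /(expg_torsionfree tors).
  exact: WpX.
exists [set t | forall n, mulset (B n) (W n) t]; split.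
- split=> [n|x y Tx Ty n]; first exact: (mulset_subgroup _ _).1.
  exact: (mulset_subgroup _ _).2.
- move=> t Tt Wt; apply: Wsep => n; have [b Bb Wtb] := Tt n.
  rewrite -[t](mulgVK b); apply: subgroupM => //; apply: BW => //.
  rewrite -[b](divKg (x := t)) //; apply: (sW 0).2 => //.
  exact: filtration_sub0 Wtb.
move=> x; have /choice[b bP] n : exists b, B n b /\ W 0 (x / b).
  by have [b Bb Wb] := iter_cover (sW 0) n x sU Ucov; exists b.
have [|r rP] := Wlim (b := b).
  move=> n; have [Bn Wn] := bP n; have [Bn1 Wn1] := bP n.+1.
  apply: BW; first by apply: (sB n).2 => //; apply: Bsub.
  have -> : b n.+1 / b n = (x / b n) / (x / b n.+1).
    by rewrite divgACA mulgV mul1g invgK [RHS]GC.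
  exact: (sW 0).2.
exists r.
  by move=> n; exists (b n); [have [] := bP n | exact: rP].
have [_ W0] := bP 0.
have -> : x / r = (x / b 0) / (r / b 0) by rewrite mulgKA.
exact: (sW 0).2.
Qed.
End Filtration.
End AbelianGroup.

(** * Splitting by a complement of the kernel *)

Section Splitting.
Set Implicit Arguments.
Unset Strict Implicit.
Local Open Scope classical_set_scope.
Local Open Scope group_scope.

(** Compatibility with products alone is bundled in [g]; cancellation gives the
rest. *)
Lemma multiplicativeF (B C : groupType) (g : {multiplicative B -> C}) :
  {morph g : x y / x / y}.
Proof. by move=> x y; apply: (mulIg (g y)); rewrite -gmulfM !mulgVK. Qed.

(** A residue lifts to the complement, and it does so in one way only, which
makes the lifting multiplicative. *)
Lemma complement_splits (B C : groupType) (g : {multiplicative B -> C})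
    (T : set B) :
  (forall x y : B, commute x y) -> range g = [set: C] ->
  complement (gker g) T -> splits g.
Proof.
move=> BC gsurj [sT TK Tcov].
have Tg (c : C) : exists t, T t /\ g t = c.
  have [x _ <-] : range g c by rewrite gsurj.
  have [t Tt gxt] := Tcov x; exists t; split=> //.
  by apply/esym/divg1_eq; rewrite -multiplicativeF.
pose s c := sval (cid (Tg c)).
have sP c : T (s c) /\ g (s c) = c by rewrite /s; case: cid.
have sM : {morph s : x y / x * y}.
  move=> x y; apply: divg1_eq; apply: TK.
    apply: sT.2; first exact: (sP _).1.
    by apply: subgroupM => //; apply: (sP _).1.
  by rewrite /gker /= multiplicativeF gmulfM !(sP _).2 mulgV.
pose sI := isMultiplicative.Build C B s sM.
exists (HB.pack_for {multiplicative C -> B} s sI).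
by apply: funext => c; exact: (sP c).2.
Qed.
End Splitting.

(** * The filtration of the units of a complete local ring *)

Section LocalRing.
Set Implicit Arguments.
Unset Strict Implicit.
Local Open Scope classical_set_scope.
Local Open Scope ring_scope.
Local Open Scope quotient_scope.

Lemma pi_eq (R : comNzRingType) (I : idealr R) (x y : R) :
  \pi_{ideal_quot I} x = \pi y <-> x - y \in I.
Proof. by rewrite Quotient.idealrBE; split=> /eqP. Qed.

Variables (R : comUnitRingType) (M : idealr R).

Lemma ideal_expS_mul n a b : a \in M -> b \in ideal_expS M n ->
  a * b \in ideal_expS M n.+1.
Proof.
move=> aM bM; apply/asboolP; exists [:: (a, b)]; last by rewrite big_seq1.
by move=> p; rewrite inE => /eqP->; apply/andP.
Qed.

Lemma ideal_expS_sub0 n : {subset ideal_expS M n <= M}.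
Proof. by elim: n => [|n IHn] // x /ideal_expS_sub/IHn. Qed.

(** The subgroup [1 + M^(n+1)] of the units: the shift of [ideal_expS] makes
[1 + M] the term of index [0]. *)
Definition one_plus_exp n : set (unit_group R) :=
  [set u | unit_val u - 1 \in ideal_expS M n].

(** Multiplicative and additive congruence of units agree, since the difference
and the quotient minus [1] differ by a unit factor. *)
Lemma one_plus_exp_div n (u v : unit_group R) :
  one_plus_exp n (u / v)%g <-> unit_val u - unit_val v \in ideal_expS M n.
Proof.
have E : unit_val (u / v)%g - 1 = (unit_val v)^-1 * (unit_val u - unit_val v).
  by rewrite mulrBr mulVr ?unit_valP // mulrC.
rewrite /one_plus_exp /= E; split=> [|?]; last exact: idealMr.
by move=> /(idealMr (unit_val v)); rewrite mulVKr ?unit_valP.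
Qed.

Lemma one_plus_exp_subgroup n : subgroup (one_plus_exp n).
Proof.
split=> [|x y xW yW]; first by rewrite /one_plus_exp /= subrr rpred0.
apply/one_plus_exp_div.
have -> : unit_val x - unit_val y = (unit_val x - 1) - (unit_val y - 1).
  by rewrite opprB addrA subrK.
exact: rpredB.
Qed.

Lemma unit_valX (u : unit_group R) n : unit_val (u ^+ n)%g = unit_val u ^+ n.
Proof. by elim: n => [|n IHn] //; rewrite expgS exprS -IHn. Qed.

Lemma sum_one_plus_pow x k : x - 1 \in M -> \sum_(i < k) x ^+ i - k%:R \in M.
Proof.
move=> xM; rewrite -[k in k%:R]card_ord -sumr_const -sumrB rpred_sum // => i _.
by rewrite subrX1 mulrC idealMr.
Qed.

(** Factor [u^p - 1] as [u - 1] times a sum of [p] powers of [u], which is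
congruent to [p], hence to [0], modulo [M]. *)
Lemma one_plus_exp_pow p n u : p%:R \in M ->
  one_plus_exp n u -> one_plus_exp n.+1 (u ^+ p)%g.
Proof.
move=> pM uW; rewrite /one_plus_exp /= unit_valX subrX1 mulrC.
apply: ideal_expS_mul => //; rewrite -(subrK p%:R (\sum_(i < p) _)) rpredD //.
by apply: sum_one_plus_pow; apply: ideal_expS_sub0 uW.
Qed.

(** First-order root extraction: [w = 1 + x] with [m x = v - 1], and the same
factorization of [w^m - 1] shows that the error is [x] times an element of
[M]. *)
Lemma one_plus_exp_root m n v : m%:R \is a @GRing.unit R ->
  (forall x, x \in M -> 1 + x \is a GRing.unit) ->
  one_plus_exp n v ->
  exists2 w, one_plus_exp n w & one_plus_exp n.+1 (v / w ^+ m)%g.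
Proof.
move=> mU unit1M vW; pose x := m%:R^-1 * (unit_val v - 1).
have xW : x \in ideal_expS M n by exact: idealMr.
have xM := ideal_expS_sub0 xW.
pose w := UnitGroup (unit1M x xM).
have w1 : unit_val w - 1 = x by rewrite addrC addKr.
exists w; first by rewrite /one_plus_exp /= w1.
apply/one_plus_exp_div; rewrite unit_valX.
have -> : unit_val v - unit_val w ^+ m =
    - ((\sum_(i < m) unit_val w ^+ i - m%:R) * x).
  rewrite mulrBl mulVKr // [_ * x]mulrC -{1}w1 -subrX1 opprB opprB.
  by rewrite addrA subrK.
by rewrite rpredN ideal_expS_mul // sum_one_plus_pow // w1.
Qed.

(** Injectivity of the map to the inverse limit. *)
Lemma adic_separated : adic_complete M ->
  forall u, (forall n, one_plus_exp n u) -> u = 1%g.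
Proof.
move=> [g gK _] u uW; apply: val_inj; apply: (can_inj gK).
by apply: adic_limit_eq => n; apply/pi_eq; exact: uW.
Qed.

(** Surjectivity of the map to the inverse limit; the limit is a unit because it
is congruent to the unit [b 0] modulo [M]. *)
Lemma adic_limitP : local_ring M -> adic_complete M ->
  forall b : nat -> unit_group R, (forall n, one_plus_exp n (b n.+1 / b n)%g) ->
  exists r, forall n, one_plus_exp n (r / b n)%g.
Proof.
move=> locM [g _ gK] b bW.
pose x n := \pi_({ideal_quot ideal_expS M n}) (unit_val (b n)).
have bP n : adic_proj (x n.+1) = x n.
  by rewrite adic_proj_pi; apply/pi_eq/one_plus_exp_div.
have rP n : g (AdicLimit bP) - unit_val (b n) \in ideal_expS M n.
  by apply/pi_eq; have /(congr1 (fun l => adic_coord l n)) := gK (AdicLimit bP).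
have rU : g (AdicLimit bP) \is a GRing.unit.
  rewrite (local_unitE locM); apply/negP => rM.
  have : unit_val (b 0%N) \in M by rewrite -(rpredBl _ rM); exact: (rP 0%N).
  by apply/negP; rewrite -(local_unitE locM) unit_valP.
by exists (UnitGroup rU) => n; apply/one_plus_exp_div.
Qed.

(** The residue field has a characteristic: a positive integer is a unit as soon
as its prime factors are. *)
Lemma residue_char : local_ring M ->
  (exists2 p, prime p & p%:R \in M) \/
  (forall m, (0 < m)%N -> m%:R \is a @GRing.unit R).
Proof.
move=> locM; have [|noP] := pselect (exists2 p, prime p & p%:R \in M).
  by left.
right; elim/ltn_ind=> m IHm m0; have [m1|m1] := leqP m 1.
  by have -> : m = 1%N by [apply/eqP; rewrite eqn_leq m1]; exact: unitr1.
have p_prime := pdiv_prime m1; have p_dvd := pdiv_dvd m.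
rewrite -(divnK p_dvd) natrM unitrM IHm ?ltn_Pdiv ?prime_gt1 //=.
  by rewrite (local_unitE locM); apply/negP => pM; apply: noP; exists (pdiv m).
by rewrite divn_gt0 ?prime_gt0 // dvdn_leq.
Qed.

Lemma residue_gker : gker (residue_map M) = one_plus_exp 0.
Proof.
apply/seteqP; split=> u.
  by move=> /(congr1 val) /= h; apply/(@pi_eq _ M); rewrite h rmorph1.
move=> /(@pi_eq _ M) h; apply: val_inj => /=; rewrite h; exact: rmorph1.
Qed.

Lemma residue_surj : local_ring M -> range (residue_map M) = [set: _].
Proof.
move=> locM; apply/seteqP; split=> // y _.
have xU : repr (unit_val y) \is a GRing.unit.
  rewrite (local_unitE locM); apply/negP => xM.
  suff y0 : unit_val y = 0 by have := unit_valP y; rewrite y0 unitr0.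
  rewrite -[unit_val y]reprK -(rmorph0 (\pi_{ideal_quot M})).
  by apply/pi_eq; rewrite subr0.
by exists (UnitGroup xU) => //; apply: val_inj; exact: reprK.
Qed.

(** In characteristic [p] one has [x^p - 1 = (x - 1)^p], and the residue field
is reduced. *)
Lemma residue_torsionfree p : local_ring M -> prime p -> p%:R \in M ->
  forall u, one_plus_exp 0 (u ^+ p)%g -> one_plus_exp 0 u.
Proof.
move=> locM p_prime pM u; rewrite /one_plus_exp /= unit_valX => /pi_eq upE.
have pQ : p \in [pchar {ideal_quot M}].
  rewrite inE p_prime -(rmorph_nat (\pi_{ideal_quot M})).
  rewrite -(rmorph0 (\pi_{ideal_quot M})).
  by apply/eqP/pi_eq; rewrite subr0.
have dM : (unit_val u - 1) ^+ p \in M.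
  rewrite -[_ ^+ p]subr0; apply/pi_eq; rewrite rmorphXn rmorphB /=.
  rewrite -(pFrobenius_autE pQ) pFrobenius_autB_comm; last exact: mulrC.
  rewrite !pFrobenius_autE.
  by rewrite -!rmorphXn /= upE expr1n subrr rmorph0.
by move: dM; apply: contraLR; rewrite -!(local_unitE locM); apply: unitrX.
Qed.

End LocalRing.

Theorem corollary1p6 (R : comUnitRingType) (M : idealr R)
    (localM : local_ring M) (completeM : adic_complete M) :
  short_exact (one_plus_incl M) (residue_map M) /\ splits (residue_map M).
Proof.
have UC : forall u v : unit_group R, commute u v by exact: unit_mulC.
split.
  split; last exact: residue_surj.
  - apply/seteqP; split=> u; first by move=> u1; apply: val_inj.
    by move=> ->; apply: val_inj.
  - rewrite residue_gker; apply/seteqP; split=> [_ [u _ <-]|u uM].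
      by have := svalP u; rewrite one_plusE.
    by exists (exist _ u (etrans (one_plusE M u) uM)).
have sW := @one_plus_exp_subgroup R M.
suff [T TP] : exists T, complement (one_plus_exp M 0) T.
  apply: (complement_splits (T := T)) => //; first exact: residue_surj.
  by rewrite residue_gker.
have Wsub n u : one_plus_exp M n.+1 u -> one_plus_exp M n u.
  exact: ideal_expS_sub.
have Wsep := adic_separated completeM.
have Wlim := adic_limitP localM completeM.
have [[p p_prime pM]|char0] := residue_char localM.
  apply: (pfiltration_complement UC sW Wsub Wsep Wlim p_prime).
    exact: residue_torsionfree localM p_prime pM.
  by move=> n u; apply: one_plus_exp_pow.
apply: (divisible_complement UC (sW 0%N)) => n v n0.
apply: (filtration_divisible UC sW Wsep Wlim) => k w.
by apply: one_plus_exp_root; [exact: char0 | move=> x; exact: one_plus_unit].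
Qed.
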